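(* Let $((\mathcal{A}_n),(\varphi_{j,i}))$ be an inductive system of unital Banach algebras, indexed by $\mathbb N$. If $\varinjlim\mathcal{A}_n$ is properly infinite, then there is $N\in\mathbb N$ such that $\mathcal{A}_n$ is properly infinite for every $n\ge N$.
   Context: Banach algebras are complex and have a contractive product $\|ab\|\le\|a\|\|b\|$; a unital Banach algebra has unit $1$ with $\|1\|=1$. Two idempotents $p,q$ in an algebra $\mathcal A$ are equivalent, $p\sim q$, if there are $a,b\in\mathcal A$ with $p=ab$ and $q=ba$; they are orthogonal if $pq=0=qp$. A unital algebra $\mathcal A$ is properly infinite if there are orthogonal idempotents $p,q\in\mathcal A$ with $p\sim 1$ and $q\sim 1$. An inductive system of unital Banach algebras indexed by $\mathbb N$ consists of unital Banach algebras $(\mathcal A_n)_{n\in\mathbb N}$ and, for $i\le j$, bounded unital homomorphisms $\varphi_{j,i}:\mathcal A_i\to\mathcal A_j$ with $\varphi_{i,i}=\mathrm{id}$, $\varphi_{k,j}\circ\varphi_{j,i}=\varphi_{k,i}$ for $i\le j\le k$, and $\limsup_{j\ge i}\|\varphi_{j,i}\|<\infty$ for each $i$. Its (Banach algebra) inductive limit $\mathcal A=\varinjlim\mathcal A_n$ is the unital Banach algebra characterised, uniquely up to isometric isomorphism, by: (1) for each $i$ there is a bounded unital homomorphism $\varphi_i:\mathcal A_i\to\mathcal A$ with $\|\varphi_i(a)\|\le\limsup_{j\ge i}\|\varphi_{j,i}(a)\|$ for all $a\in\mathcal A_i$; (2) $\varphi_i=\varphi_j\circ\varphi_{j,i}$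 for $i\le j$; (3) if $\mathcal B$ is a unital Banach algebra with bounded unital homomorphisms $\phi_i:\mathcal A_i\to\mathcal B$ such that $\phi_i=\phi_j\circ\varphi_{j,i}$ for $i\le j$ and $\|\phi_i(a)\|\le\limsup_{j\ge i}\|\varphi_{j,i}(a)\|$ for all $i$ and $a\in\mathcal A_i$, then there is a unique contractive unital homomorphism $\phi:\mathcal A\to\mathcal B$ with $\phi\circ\varphi_i=\phi_i$ for each $i$. Equivalently, $\mathcal A$ is the completion of the union of the images $\varphi_i(\mathcal A_i)$, where $\|\varphi_i(a)\|=\limsup_{j\ge i}\|\varphi_{j,i}(a)\|$. *)

(* Defs.v *)
From HB Require Import structures.
From mathcomp Require Import all_boot all_order all_algebra.
From mathcomp Require Import complex.
From mathcomp Require Import all_classical all_reals all_analysis.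

Set Implicit Arguments.
Unset Strict Implicit.
Unset Printing Implicit Defensive.

Import Order.TTheory GRing.Theory Num.Theory.
Import numFieldNormedType.Exports.

Local Open Scope classical_set_scope.
Local Open Scope ring_scope.

(* The only join of normed groups and rings in the hierarchy is [numDomainType],
   so no structure can inherit from both [completeNormedModType] and [algType].
   The product and unit are therefore raw operations here, and the [algType]
   structure is derived from them below, over the same underlying module. *)
HB.mixin Record isUnitalBanachAlgebra (K : numFieldType) A
    of CompleteNormedModule K A := {
  banach_one : A ;
  banach_mul : A -> A -> A ;
  banach_mulA : associative banach_mul ;
  banach_mul1l : left_id banach_one banach_mul ;
  banach_mul1r : right_id banach_one banach_mul ;
  banach_mulDl : left_distributive banach_mul +%R ;
  banach_mulDr : right_distributive banach_mul +%R ;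
  banach_scaleAl : forall (k : K) (a b : A),
    k *: banach_mul a b = banach_mul (k *: a) b ;
  banach_scaleAr : forall (k : K) (a b : A),
    k *: banach_mul a b = banach_mul a (k *: b) ;
  banach_norm_mul : forall a b : A, `|banach_mul a b| <= `|a| * `|b| ;
  banach_norm_one : `|banach_one| = 1
}.

#[short(type="unitalBanachAlgType")]
HB.structure Definition UnitalBanachAlgebra (K : numFieldType) :=
  {A of CompleteNormedModule K A & isUnitalBanachAlgebra K A}.

Fact banach_one_neq0 (K : numFieldType) (A : unitalBanachAlgType K) :
  (banach_one : A) != 0.
Proof. by rewrite -normr_eq0 banach_norm_one oner_neq0. Qed.

#[non_forgetful_inheritance]
HB.instance Definition _ (K : numFieldType) (A : unitalBanachAlgType K) :=
  GRing.Zmodule_isNzRing.Build (UnitalBanachAlgebra.sort A)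
    banach_mulA banach_mul1l banach_mul1r banach_mulDl banach_mulDr
    (banach_one_neq0 A).

#[non_forgetful_inheritance]
HB.instance Definition _ (K : numFieldType) (A : unitalBanachAlgType K) :=
  GRing.Lmodule_isLalgebra.Build K (UnitalBanachAlgebra.sort A) banach_scaleAl.

#[non_forgetful_inheritance]
HB.instance Definition _ (K : numFieldType) (A : unitalBanachAlgType K) :=
  GRing.Lalgebra_isAlgebra.Build K (UnitalBanachAlgebra.sort A) banach_scaleAr.

(* In a normed module over R[i] the library's norm takes its values in R[i];
   they are nonnegative there, hence real, so taking Re loses nothing. *)
Definition rnorm (R : realType) (V : normedModType R[i]) (x : V) : R :=
  complex.Re `|x|.

Definition idem_elt (A : pzRingType) (p : A) : Prop := p * p = p.

Definition idem_equiv (A : pzRingType) (p q : A) : Prop :=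
  exists a b : A, p = a * b /\ q = b * a.

Definition idem_orth (A : pzRingType) (p q : A) : Prop :=
  p * q = 0 /\ q * p = 0.

Definition properly_infinite (A : pzRingType) : Prop :=
  exists p q : A,
    [/\ idem_elt p, idem_elt q, idem_orth p q, idem_equiv p 1 & idem_equiv q 1].

Section Maps.
Variables (R : realType) (A B : unitalBanachAlgType R[i]).

Definition bounded_map (f : A -> B) : Prop :=
  exists M : R, forall a : A, rnorm (f a) <= M * rnorm a.

Definition contractive_map (f : A -> B) : Prop :=
  forall a : A, rnorm (f a) <= rnorm a.

Definition op_norm (f : A -> B) : \bar R :=
  ereal_sup [set (rnorm (f a))%:E | a in [set a : A | rnorm a <= 1]].

End Maps.

Section InductiveSystem.
Variables (R : realType) (A : nat -> unitalBanachAlgType R[i]).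

(* [phi i j le_ij] is the connecting map from [A i] to [A j]; a unital algebra
   homomorphism is an [{lrmorphism _ -> _}]. *)
Variable phi : forall i j : nat, (i <= j)%N -> {lrmorphism A i -> A j}.

(* The limits superior over j >= i are taken along j = i + k, k -> oo. *)
Definition limsup_op_norm (i : nat) : \bar R :=
  limn_esup (fun k : nat => op_norm (phi (leq_addr k i))).

Definition limsup_norm (i : nat) (a : A i) : \bar R :=
  limn_esup (fun k : nat => (rnorm (phi (leq_addr k i) a))%:E).

Record inductive_system : Prop := InductiveSystem {
  ind_bounded : forall i j (ij : (i <= j)%N), bounded_map (phi ij) ;
  ind_id : forall i (ii : (i <= i)%N) (a : A i), phi ii a = a ;
  ind_comp : forall i j k (ij : (i <= j)%N) (jk : (j <= k)%N) (ik : (i <= k)%N)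
    (a : A i), phi jk (phi ij a) = phi ik a ;
  ind_limsup : forall i, (limsup_op_norm i < +oo)%E
}.

Record compatible_cone (B : unitalBanachAlgType R[i])
    (psi : forall i, {lrmorphism A i -> B}) : Prop := CompatibleCone {
  cone_bounded : forall i, bounded_map (psi i) ;
  cone_norm : forall i (a : A i), ((rnorm (psi i a))%:E <= limsup_norm a)%E ;
  cone_comp : forall i j (ij : (i <= j)%N) (a : A i),
    psi i a = psi j (phi ij a)
}.

Record is_inductive_limit (L : unitalBanachAlgType R[i])
    (iota : forall i, {lrmorphism A i -> L}) : Prop := IsInductiveLimit {
  lim_cone : compatible_cone iota ;
  lim_universal : forall (B : unitalBanachAlgType R[i])
      (psi : forall i, {lrmorphism A i -> B}), compatible_cone psi ->
    exists Phi : {lrmorphism L -> B},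
      [/\ contractive_map Phi,
          forall i (a : A i), Phi (iota i a) = psi i a
        & forall Phi' : {lrmorphism L -> B}, contractive_map Phi' ->
            (forall i (a : A i), Phi' (iota i a) = psi i a) -> Phi' =1 Phi]
}.

End InductiveSystem.

(* Main.v *)
(** Bounded sequences in the product of the [A n], modulo null sequences and
    normed by the limit superior, form a unital Banach algebra [Q]. Mapping
    [a : A i] to the class of its images [phi i n a], n >= i, is a compatible
    cone, so the universal property gives a unital homomorphism from the limit
    to [Q], and [Q] is properly infinite. Proper infiniteness means that there
    are a, b, c, d with ba = dc = 1 and bc = da = 0; representatives of such
    elements of [Q] satisfy these relations up to 1/4 in all but finitely many
    [A n], where they can be corrected to exact ones by Neumann series. *)
Require Import Defs.
From HB Require Import structures.
From mathcomp Require Import all_boot all_order all_algebra.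
From mathcomp Require Import complex.
From mathcomp Require Import all_classical all_reals all_analysis.
From mathcomp Require Import generic_quotient lra.

Set Implicit Arguments.
Unset Strict Implicit.
Unset Printing Implicit Defensive.

Import Order.TTheory GRing.Theory Num.Theory.
Import numFieldNormedType.Exports.

Local Open Scope classical_set_scope.
Local Open Scope ring_scope.
Local Open Scope complex_scope.

(** * Real-valued norms and completeness *)

Section RealNorm.
Variables (R : realType) (V : normedModType R[i]).
Implicit Types (x y : V) (k : R[i]).

Lemma rnormE x : `|x| = (rnorm x)%:C.
Proof. by rewrite /rnorm RRe_real // ger0_real. Qed.

Lemma rnorm_ge0 x : 0 <= rnorm x.
Proof. by rewrite -lecR -rnormE normr_ge0. Qed.

Lemma rnorm0 : rnorm (0 : V) = 0.
Proof. by rewrite /rnorm normr0. Qed.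

Lemma rnorm0_eq0 x : rnorm x = 0 -> x = 0.
Proof. by move=> x0; apply/normr0_eq0; rewrite rnormE x0. Qed.

Lemma rnormD x y : rnorm (x + y) <= rnorm x + rnorm y.
Proof. by rewrite -lecR rmorphD /= -!rnormE ler_normD. Qed.

Lemma rnormN x : rnorm (- x) = rnorm x.
Proof. by rewrite /rnorm normrN. Qed.

Lemma rnorm_sub x y : rnorm (x - y) = rnorm (y - x).
Proof. by rewrite -rnormN opprB. Qed.

Lemma rnormZ k x : rnorm (k *: x) = complex.Re `|k| * rnorm x.
Proof.
by apply: complexI; rewrite rmorphM /= -!rnormE normrZ.
Qed.

Lemma rnorm_dist x y z : rnorm (x - z) <= rnorm (x - y) + rnorm (y - z).
Proof. by rewrite -[x - z](subrKA y) rnormD. Qed.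

End RealNorm.

Section BanachNorm.
Variables (R : realType) (B : unitalBanachAlgType R[i]).
Implicit Types x y : B.

Lemma rnormM x y : rnorm (x * y) <= rnorm x * rnorm y.
Proof. by rewrite -lecR rmorphM /= -!rnormE banach_norm_mul. Qed.

Lemma rnorm1 : rnorm (1 : B) = 1.
Proof. by rewrite /rnorm banach_norm_one. Qed.

End BanachNorm.

(** Positive elements of [R[i]] are real, so Cauchy estimates with real tolerances already yield a
    Cauchy filter. *)
Lemma rnorm_complete (R : realType) (V : completeNormedModType R[i])
    (u : nat -> V) :
  (forall e : R, 0 < e ->
    exists N, forall m n, (N <= m <= n)%N -> rnorm (u m - u n) <= e) ->
  exists l, forall e : R, 0 < e -> \forall n \near \oo, rnorm (l - u n) <= e.
Proof.
move=> uC; have posE (e : R[i]) : 0 < e -> exists2 r : R, 0 < r & e = r%:C.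
  move=> e0; exists (complex.Re e); last by rewrite RRe_real// gtr0_real.
  by rewrite -ltcR RRe_real// gtr0_real.
have /cauchy_cvgP/cvg_ex[l ul] : cauchy (u @ \oo).
  apply/cauchy_exP => _ /posE[r r0 ->].
  have [N uN] := uC (r / 2) ltac:(lra).
  exists (u N); exists N => // n /= Nn; rewrite -ball_normE /=.
  rewrite rnormE ltcR (le_lt_trans (uN _ _ _)) ?leqnn //; lra.
exists l => e e0; move/cvgrPdist_le: ul => /(_ e%:C); rewrite ltcR => /(_ e0).
by apply: filterS => n; rewrite rnormE lecR.
Qed.

(** * Neumann series *)

Section Neumann.
Variables (R : realType) (B : unitalBanachAlgType R[i]).

(** With [e = 1 - u], the partial sums [s n] of the geometric series in [e] satisfy
    [u * s n = 1 - e ^+ n]; they are Cauchy, and [r] is their limit. *)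
Lemma neumann_right_inverse (u : B) (q : R) : q < 1 -> rnorm (u - 1) <= q ->
  exists2 r : B, u * r = 1 & rnorm r <= (1 - q)^-1.
Proof.
move=> q1; rewrite rnorm_sub; set e : B := 1 - u => eq.
have q0 : 0 <= q := le_trans (rnorm_ge0 _) eq.
have eX n : rnorm (e ^+ n) <= q ^+ n.
  elim: n => [|n IH]; first by rewrite !expr0 rnorm1.
  by rewrite !exprS (le_trans (rnormM _ _)) ?ler_pM ?rnorm_ge0.
pose s n : B := \sum_(i < n) e ^+ i.
have sE n : u * s n = 1 - e ^+ n.
  by rewrite -[in RHS]opprB subrX1 -mulNr opprB subKr.
(* By induction: [s n.+1 = 1 + e * s n], and [(1 - q)^-1] is the fixed point of [t -> 1 + q * t]. *)
have s_bound n : rnorm (s n) <= (1 - q)^-1.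
  rewrite -div1r ler_pdivlMr ?subr_gt0 //.
  elim: n => [|n IH]; first by rewrite /s big_ord0 rnorm0 mul0r.
  have -> : s n.+1 = 1 + e * s n.
    rewrite /s big_ord_recl expr0 mulr_sumr; congr (_ + _).
    by apply: eq_bigr => i _; rewrite exprS.
  have := rnormD (1 : B) (e * s n); have := rnormM e (s n); rewrite rnorm1.
  have := ler_wpM2r (rnorm_ge0 (s n)) eq; nra.
have sB m n : (m <= n)%N -> rnorm (s m - s n) <= q ^+ m * (1 - q)^-1.
  move=> mn; rewrite rnorm_sub -(subnKC mn) /s big_split_ord /=.
  rewrite addrAC subrr add0r.
  under eq_bigr do rewrite exprD.
  rewrite -mulr_sumr (le_trans (rnormM _ _)) // ler_pM ?rnorm_ge0 //.
  exact: s_bound.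
have qX (d : R) : 0 < d -> \forall n \near \oo, q ^+ n <= d.
  move=> d0; have /cvgrPdist_le/(_ _ d0) : q ^+ n @[n --> \oo] --> (0 : R).
    by apply: cvg_expr; rewrite ger0_norm.
  by apply: filterS => n; rewrite sub0r normrN ger0_norm // exprn_ge0.
have [|r sr] := @rnorm_complete _ _ s.
  move=> d d0; have [|N _ HN] := qX (d * (1 - q)).
    by rewrite mulr_gt0 // subr_gt0.
  exists N => m n /andP[Nm mn]; apply: le_trans (sB _ _ mn) _.
  by rewrite ler_pdivrMr ?subr_gt0 //; apply: HN.
exists r.
  apply/subr0_eq/rnorm0_eq0/eqP; rewrite eq_le rnorm_ge0 andbT.
  apply/ler_addgt0Pl => d d0; rewrite addr0.
  (* The two terms of [u * (r - s n) - e ^+ n] get [d / 2] each; adding 1 to [rnorm u] keeps the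
     divisor positive. *)
  have u0 : 0 < rnorm u + 1 by rewrite ltr_wpDl // rnorm_ge0.
  have d1 : 0 < d / 2 / (rnorm u + 1) by rewrite !divr_gt0.
  have d2 : 0 < d / 2 by rewrite divr_gt0.
  have [n [srn qn]] := @filter_ex _ _ _ _ (filterI (sr _ d1) (qX _ d2)).
  have -> : u * r - 1 = u * (r - s n) - e ^+ n.
    by rewrite mulrBr sE opprB addrA addrAC addrK.
  rewrite (le_trans (rnormD _ _)) // rnormN [leRHS]splitr lerD //; last first.
    exact: le_trans (eX n) qn.
  rewrite (le_trans (rnormM _ _)) //.
  rewrite (le_trans (ler_wpM2l (rnorm_ge0 _) srn)) //.
  by rewrite mulrCA ger_pMr // ler_pdivrMr // mul1r lerDl.
apply/ler_addgt0Pl => d d0.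
have [n srn] := @filter_ex _ _ _ _ (sr _ d0).
rewrite -[r](subrK (s n)) (le_trans (rnormD _ _)) // lerD //.
Qed.

End Neumann.

(** * Proper infiniteness by one-sided inverses, and its stability *)

(** If [p = a * b], [q = c * d] and [b * a = 1 = d * c], then [b * c = b * (p * q) * c], so
    orthogonality kills the cross products; conversely, [a * b] and [c * d] serve as the
    idempotents. *)
Lemma properly_infinite_isometriesP (A : pzRingType) : properly_infinite A <->
  exists a b c d : A, [/\ b * a = 1, d * c = 1, b * c = 0 & d * a = 0].
Proof.
split=> [[p [q [_ _ [pq qp] [a [b [pE ba]]] [c [d [qE dc]]]]]]|].
  exists a, b, c, d; split=> //.
    have -> : b * c = b * (p * q) * c.
      by rewrite pE qE !mulrA -ba mul1r -!mulrA -dc mulr1.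
    by rewrite pq mulr0 mul0r.
  have -> : d * a = d * (q * p) * a.
    by rewrite pE qE !mulrA -dc mul1r -!mulrA -ba mulr1.
  by rewrite qp mulr0 mul0r.
move=> [a [b [c [d [ba dc bc da]]]]]; exists (a * b), (c * d); split.
- by rewrite /idem_elt mulrA -(mulrA a) ba mulr1.
- by rewrite /idem_elt mulrA -(mulrA c) dc mulr1.
- by rewrite /idem_orth !mulrA -(mulrA a) bc -(mulrA c) da !mulr0 !mul0r.
- by exists a, b.
- by exists c, d.
Qed.

Lemma rmorph_properly_infinite (A B : pzRingType) (f : {rmorphism A -> B}) :
  properly_infinite A -> properly_infinite B.
Proof.
move=> /properly_infinite_isometriesP[a [b [c [d [ba dc bc da]]]]].
apply/properly_infinite_isometriesP; exists (f a), (f b), (f c), (f d).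
by rewrite -!rmorphM ba dc bc da rmorph0 rmorph1.
Qed.

(* Correct the approximate isometries one after the other: first [a], then [c],
   then [d]; [b] is left unchanged. *)
Lemma properly_infinite_perturb (R : realType) (B : unitalBanachAlgType R[i])
    (a b c d : B) :
  rnorm (b * a - 1) <= 4^-1 -> rnorm (d * c - 1) <= 4^-1 ->
  rnorm (b * c) <= 4^-1 -> rnorm (d * a) <= 4^-1 ->
  properly_infinite B.
Proof.
move=> ba dc bc da; apply/properly_infinite_isometriesP.
have [|r bar rn] := neumann_right_inverse _ ba; first by lra.
(* Since [b * (a * r) = 1], removing from [c] its part along [a * r] makes [b] annihilate it. *)
pose c' := c - a * r * (b * c).
have bc' : b * c' = 0 by rewrite mulrBr !mulrA bar mul1r subrr.
have dc' : rnorm (d * c' - 1) <= 2^-1.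
  rewrite mulrBr addrAC (le_trans (rnormD _ _)) // rnormN.
  have -> : d * (a * r * (b * c)) = d * a * (r * (b * c)) by rewrite !mulrA.
  have := rnormM (d * a) (r * (b * c)); have := rnormM r (b * c).
  have := rnorm_ge0 r; have := rnorm_ge0 (b * c); have := rnorm_ge0 (d * a).
  (* Here [(1 - 1/4)^-1 = 4/3] is rounded up to 2; the total error is then at most
     [1/4 + 1/4 * 2 * 1/4 < 1/2]. *)
  have {}rn : rnorm r <= 2.
    apply: le_trans rn _; rewrite invf_ple ?posrE; lra.
  move=> da0 bc0 r0 rbc darbc.
  have h1 : rnorm (r * (b * c)) <= 2^-1 by nra.
  have := rnorm_ge0 (r * (b * c)).
  nra.
have [|s dcs _] := neumann_right_inverse _ dc'; first by lra.
(* As [b * c' = 0], subtracting a left multiple of [b] from [d] does not change its product with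
   [c' * s]; the multiple is chosen so that the result annihilates [a * r]. *)
exists (a * r), b, (c' * s), (d - d * (a * r) * b); split.
- by rewrite mulrA.
- rewrite mulrBl (mulrA d c') dcs -(mulrA _ b) (mulrA b).
  by rewrite bc' mul0r mulr0 subr0.
- by rewrite mulrA bc' mul0r.
- by rewrite mulrBl -(mulrA _ b) (mulrA b) bar mulr1 subrr.
Qed.

(** * Bounded sequences and the limit superior of their norms *)

Section BoundedSequences.
Variables (R : realType) (A : nat -> unitalBanachAlgType R[i]).

(* Boundedness is only required eventually: the finitely many remaining terms
   do not affect the limit superior. *)
Record bdd_seq := BddSeq {
  bdd_seq_val :> forall n, A n ;
  bdd_seqP : exists M : R, \forall n \near \oo, rnorm (bdd_seq_val n) <= M
}.

HB.instance Definition _ := gen_eqMixin bdd_seq.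
HB.instance Definition _ := gen_choiceMixin bdd_seq.

Implicit Types (x y z : bdd_seq) (k : R[i]) (r : R).

Fact bdd0_subproof :
  exists M : R, \forall n \near \oo, rnorm (0 : A n) <= M.
Proof. by exists 0; apply: nearW => n; rewrite rnorm0. Qed.
Definition bdd0 := BddSeq bdd0_subproof.

Fact bdd1_subproof :
  exists M : R, \forall n \near \oo, rnorm (1 : A n) <= M.
Proof. by exists 1; apply: nearW => n; rewrite rnorm1. Qed.
Definition bdd1 := BddSeq bdd1_subproof.

Fact bddN_subproof x :
  exists M : R, \forall n \near \oo, rnorm (- x n) <= M.
Proof.
by have [M xM] := bdd_seqP x; exists M; apply: filterS xM => n; rewrite rnormN.
Qed.
Definition bddN x := BddSeq (bddN_subproof x).

Fact bddD_subproof x y :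
  exists M : R, \forall n \near \oo, rnorm (x n + y n) <= M.
Proof.
have [M xM] := bdd_seqP x; have [N yN] := bdd_seqP y; exists (M + N).
by apply: filterS2 xM yN => n xM yN; rewrite (le_trans (rnormD _ _)) ?lerD.
Qed.
Definition bddD x y := BddSeq (bddD_subproof x y).

Fact bddZ_subproof k x :
  exists M : R, \forall n \near \oo, rnorm (k *: x n) <= M.
Proof.
have [M xM] := bdd_seqP x; exists (complex.Re `|k| * M).
apply: filterS xM => n xM; rewrite rnormZ ler_wpM2l //.
exact: (@rnorm_ge0 R R[i]^o k).
Qed.
Definition bddZ k x := BddSeq (bddZ_subproof k x).

Fact bddM_subproof x y :
  exists M : R, \forall n \near \oo, rnorm (x n * y n) <= M.
Proof.
have [M xM] := bdd_seqP x; have [N yN] := bdd_seqP y; exists (M * N).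
apply: filterS2 xM yN => n xM yN; rewrite (le_trans (rnormM _ _)) //.
by rewrite ler_pM ?rnorm_ge0.
Qed.
Definition bddM x y := BddSeq (bddM_subproof x y).

(** As an infimum of eventual bounds it is a genuine real: [bdd_seqP] makes the set nonempty, and 0
    is a lower bound. *)
Definition limsup_rnorm x : R :=
  inf [set r | \forall n \near \oo, rnorm (x n) <= r].

Lemma limsup_rnorm_lbound x :
  lbound [set r | \forall n \near \oo, rnorm (x n) <= r] 0.
Proof.
move=> r /= xr; have [n xn] := @filter_ex _ _ _ _ xr.
exact: le_trans (rnorm_ge0 _) xn.
Qed.

Lemma limsup_rnorm_le x r :
  (\forall n \near \oo, rnorm (x n) <= r) -> limsup_rnorm x <= r.
Proof.
by move=> xr; apply: ge_inf => //; exists 0; apply: limsup_rnorm_lbound.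
Qed.

Lemma limsup_rnorm_lt x r :
  limsup_rnorm x < r -> \forall n \near \oo, rnorm (x n) <= r.
Proof.
move=> /(inf_lt (bdd_seqP x))[s xs sr].
by apply: filterS xs => n xs; rewrite (le_trans xs) // ltW.
Qed.

Lemma limsup_rnorm_ge0 x : 0 <= limsup_rnorm x.
Proof. by apply: lb_le_inf; [exact: bdd_seqP|exact: limsup_rnorm_lbound]. Qed.

Lemma limsup_rnormD x y :
  limsup_rnorm (bddD x y) <= limsup_rnorm x + limsup_rnorm y.
Proof.
apply/ler_addgt0Pl => e e0; have e20 : 0 < e / 2 by rewrite divr_gt0.
have xe : limsup_rnorm x < limsup_rnorm x + e / 2 by rewrite ltrDl.
have ye : limsup_rnorm y < limsup_rnorm y + e / 2 by rewrite ltrDl.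
apply: limsup_rnorm_le.
apply: filterS2 (limsup_rnorm_lt xe) (limsup_rnorm_lt ye) => n xn yn /=.
have := rnormD (x n) (y n); lra.
Qed.

Lemma limsup_rnormM x y :
  limsup_rnorm (bddM x y) <= limsup_rnorm x * limsup_rnorm y.
Proof.
have bound r s : limsup_rnorm x < r -> limsup_rnorm y < s ->
    limsup_rnorm (bddM x y) <= r * s.
  move=> xr ys; apply: limsup_rnorm_le.
  apply: filterS2 (limsup_rnorm_lt xr) (limsup_rnorm_lt ys) => n xn yn /=.
  by rewrite (le_trans (rnormM _ _)) // ler_pM ?rnorm_ge0.
have x0 := limsup_rnorm_ge0 x; have y0 := limsup_rnorm_ge0 y.
apply/ler_addgt0Pl => e e0.
(* Write [X], [Y] for the two limits superior and [d = e / c <= 1]: the excess of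
   [(X + d) * (Y + d)] over [X * Y] is [d * (X + Y + d) <= d * c = e]. *)
pose c := limsup_rnorm x + limsup_rnorm y + 1 + e.
have c0 : 0 < c by rewrite /c; lra.
have d0 : 0 < e / c by rewrite divr_gt0.
have dc : e / c * c = e by rewrite divfK // gt_eqF.
have d1 : e / c <= 1 by rewrite ler_pdivrMr // mul1r /c; lra.
apply: le_trans (bound (limsup_rnorm x + e / c) (limsup_rnorm y + e / c) _ _) _.
- by rewrite ltrDl.
- by rewrite ltrDl.
- move: dc d0 d1; rewrite {2}/c; move: (e / c) => d; nra.
Qed.

Lemma limsup_rnorm1 : limsup_rnorm bdd1 = 1.
Proof.
apply/eqP; rewrite eq_le limsup_rnorm_le /=; last first.
  by apply: nearW => n; rewrite rnorm1.
apply: lb_le_inf; first exact: bdd_seqP.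
by move=> r /= /(@filter_ex _ _ _ _)[n]; rewrite rnorm1.
Qed.

Lemma limsup_rnormZ_le k x :
  limsup_rnorm (bddZ k x) <= complex.Re `|k| * limsup_rnorm x.
Proof.
have k0 : 0 <= complex.Re `|k| := @rnorm_ge0 R R[i]^o k.
apply/ler_addgt0Pl => e e0.
(* The summand 1 keeps [c] positive when [k = 0]. *)
pose c := complex.Re `|k| + 1; have c0 : 0 < c by rewrite /c; lra.
have xe : limsup_rnorm x < limsup_rnorm x + e / c by rewrite ltrDl divr_gt0.
apply: limsup_rnorm_le; apply: filterS (limsup_rnorm_lt xe) => n xn /=.
rewrite rnormZ (le_trans (ler_wpM2l k0 xn)) // mulrDr addrC lerD2r.
by rewrite mulrCA ger_pMr // ler_pdivrMr // mul1r lerDl.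
Qed.

(** * Congruence modulo null sequences *)

Definition null_dist x y : bool := limsup_rnorm (bddD x (bddN y)) == 0.

Lemma null_distP x y : reflect
  (forall e : R, 0 < e -> \forall n \near \oo, rnorm (x n - y n) <= e)
  (null_dist x y).
Proof.
apply: (iffP eqP) => [xy e e0|xy]; 
  first by move: e0; rewrite -[X in X < _]xy; apply: limsup_rnorm_lt.
apply/eqP; rewrite eq_le limsup_rnorm_ge0 andbT; apply/ler_addgt0Pl => e e0.
by rewrite addr0; apply: limsup_rnorm_le; apply: xy.
Qed.

Lemma null_dist_refl : reflexive null_dist.
Proof.
move=> x; apply/null_distP => e e0; apply: nearW => n.
by rewrite subrr rnorm0 ltW.
Qed.

Lemma null_dist_sym : symmetric null_dist.
Proof.
by move=> x y; apply/null_distP/null_distP => xy e /xy;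
  apply: filterS => n; rewrite rnorm_sub.
Qed.

Lemma null_dist_trans : transitive null_dist.
Proof.
move=> y x z /null_distP xy /null_distP yz; apply/null_distP => e e0.
have e20 : 0 < e / 2 by rewrite divr_gt0.
apply: filterS2 (xy _ e20) (yz _ e20) => n xyn yzn.
by rewrite (le_trans (rnorm_dist _ (y n) _)) // [e]splitr lerD.
Qed.

Canonical null_dist_equiv :=
  EquivRel null_dist null_dist_refl null_dist_sym null_dist_trans.

(** Makes the quotient norm independent of the representative; by symmetry one inequality
    suffices. *)
Lemma limsup_rnorm_null x y : null_dist x y -> limsup_rnorm x = limsup_rnorm y.
Proof.
wlog suff le_xy : x y / null_dist x y -> limsup_rnorm x <= limsup_rnorm y.
  by move=> xy; apply/eqP; rewrite eq_le !le_xy // null_dist_sym.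
move=> /null_distP xy; apply/ler_addgt0Pl => e e0.
have e20 : 0 < e / 2 by rewrite divr_gt0.
have ye : limsup_rnorm y < limsup_rnorm y + e / 2 by rewrite ltrDl.
apply: limsup_rnorm_le.
apply: filterS2 (xy _ e20) (limsup_rnorm_lt ye) => n xyn yn.
have := rnormD (x n - y n) (y n); rewrite subrK; lra.
Qed.

Lemma null_distN x x' : null_dist x x' -> null_dist (bddN x) (bddN x').
Proof.
move=> /null_distP xx; apply/null_distP => e /xx; apply: filterS => n /=.
by rewrite -opprD rnormN.
Qed.

Lemma null_distD x x' y y' :
  null_dist x x' -> null_dist y y' -> null_dist (bddD x y) (bddD x' y').
Proof.
move=> /null_distP xx /null_distP yy; apply/null_distP => e e0.
have e20 : 0 < e / 2 by rewrite divr_gt0.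
apply: filterS2 (xx _ e20) (yy _ e20) => n xn yn /=.
by rewrite opprD addrACA (le_trans (rnormD _ _)) // [e]splitr lerD.
Qed.

Lemma null_distZ k x x' : null_dist x x' -> null_dist (bddZ k x) (bddZ k x').
Proof.
move=> /eqP xx; rewrite /null_dist eq_le limsup_rnorm_ge0 andbT.
have -> : limsup_rnorm (bddD (bddZ k x) (bddN (bddZ k x'))) =
          limsup_rnorm (bddZ k (bddD x (bddN x'))).
  by apply/limsup_rnorm_null/null_distP => e e0; apply: nearW => n /=;
    rewrite scalerBr subrr rnorm0 ltW.
by rewrite (le_trans (limsup_rnormZ_le _ _)) // xx mulr0.
Qed.

Lemma null_distM x x' y y' :
  null_dist x x' -> null_dist y y' -> null_dist (bddM x y) (bddM x' y').
Proof.
move=> /eqP xx /eqP yy; rewrite /null_dist eq_le limsup_rnorm_ge0 andbT.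
(* Splits [x * y - x' * y'] as [(x - x') * y + x' * (y - y')]; each summand has a factor of limit
   superior 0. *)
have -> : limsup_rnorm (bddD (bddM x y) (bddN (bddM x' y'))) =
  limsup_rnorm (bddD (bddM (bddD x (bddN x')) y) (bddM x' (bddD y (bddN y')))).
  apply/limsup_rnorm_null/null_distP => e e0; apply: nearW => n /=.
  by rewrite mulrBl mulrBr subrKA subrr rnorm0 ltW.
apply: le_trans (limsup_rnormD _ _) _.
apply: le_trans (lerD (limsup_rnormM _ _) (limsup_rnormM _ _)) _.
by rewrite xx yy mul0r mulr0 addr0.
Qed.

(** * The reduced product as a unital Banach algebra *)

Local Open Scope quotient_scope.

Definition reduced_product := {eq_quot null_dist_equiv}.

HB.instance Definition _ := Choice.on reduced_product.
HB.instance Definition _ := Quotient.on reduced_product.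

Implicit Types p q : reduced_product.

Definition cls x : reduced_product := \pi x.

Lemma cls_eqP x y : cls x = cls y <-> null_dist x y.
Proof. by split=> /eqmodP. Qed.

Lemma cls_ext x y : (forall n, x n = y n) -> cls x = cls y.
Proof.
move=> xy; apply/cls_eqP/null_distP => e e0; apply: nearW => n.
by rewrite xy subrr rnorm0 ltW.
Qed.

Lemma clsK p : cls (repr p) = p.
Proof. exact: reprK. Qed.

Lemma clsP p : exists x, p = cls x.
Proof. by exists (repr p); rewrite clsK. Qed.

Lemma repr_cls x : null_dist (repr (cls x)) x.
Proof. by apply/cls_eqP; rewrite clsK. Qed.

(** The operations act on chosen representatives; the equations collected in [rpE] show that any
    other choice gives the same result. *)
Definition rp_opp p := cls (bddN (repr p)).
Definition rp_add p q := cls (bddD (repr p) (repr q)).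
Definition rp_scale k p := cls (bddZ k (repr p)).
Definition rp_mul p q := cls (bddM (repr p) (repr q)).
Definition rp_norm p : R[i] := (limsup_rnorm (repr p))%:C.

Lemma rp_oppE x : rp_opp (cls x) = cls (bddN x).
Proof. exact/cls_eqP/null_distN/repr_cls. Qed.

Lemma rp_addE x y : rp_add (cls x) (cls y) = cls (bddD x y).
Proof. by apply/cls_eqP/null_distD; apply: repr_cls. Qed.

Lemma rp_scaleE k x : rp_scale k (cls x) = cls (bddZ k x).
Proof. exact/cls_eqP/null_distZ/repr_cls. Qed.

Lemma rp_mulE x y : rp_mul (cls x) (cls y) = cls (bddM x y).
Proof. by apply/cls_eqP/null_distM; apply: repr_cls. Qed.

Lemma rp_normE x : rp_norm (cls x) = (limsup_rnorm x)%:C.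
Proof. by congr (_%:C); apply/limsup_rnorm_null/repr_cls. Qed.

Definition rpE := (rp_oppE, rp_addE, rp_scaleE, rp_mulE, rp_normE).

Fact rp_addA : associative rp_add.
Proof.
move=> p q r; have [[[x ->] [y ->]] [z ->]] := (clsP p, clsP q, clsP r).
by rewrite !rpE; apply: cls_ext => n /=; rewrite addrA.
Qed.

Fact rp_addC : commutative rp_add.
Proof.
move=> p q; have [[x ->] [y ->]] := (clsP p, clsP q).
by rewrite !rpE; apply: cls_ext => n /=; rewrite addrC.
Qed.

Fact rp_add0 : left_id (cls bdd0) rp_add.
Proof.
move=> p; have [x ->] := clsP p.
by rewrite !rpE; apply: cls_ext => n /=; rewrite add0r.
Qed.

Fact rp_addN : left_inverse (cls bdd0) rp_opp rp_add.
Proof.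
move=> p; have [x ->] := clsP p.
by rewrite !rpE; apply: cls_ext => n /=; rewrite addNr.
Qed.

HB.instance Definition _ :=
  GRing.isZmodule.Build reduced_product rp_addA rp_addC rp_add0 rp_addN.

Fact rp_scaleA k l p : rp_scale k (rp_scale l p) = rp_scale (k * l) p.
Proof.
have [x ->] := clsP p.
by rewrite !rpE; apply: cls_ext => n /=; rewrite scalerA.
Qed.

Fact rp_scale1 : left_id 1 rp_scale.
Proof.
move=> p; have [x ->] := clsP p.
by rewrite !rpE; apply: cls_ext => n /=; rewrite scale1r.
Qed.

Fact rp_scaleDr : right_distributive rp_scale +%R.
Proof.
move=> k p q; have [[x ->] [y ->]] := (clsP p, clsP q).
by rewrite /+%R /= !rpE; apply: cls_ext => n /=; rewrite scalerDr.
Qed.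

Fact rp_scaleDl p : {morph rp_scale^~ p : k l / k + l}.
Proof.
move=> k l; have [x ->] := clsP p.
by rewrite [RHS]/+%R /= !rpE; apply: cls_ext => n /=; rewrite scalerDl.
Qed.

HB.instance Definition _ := GRing.Zmodule_isLmodule.Build R[i] reduced_product
  rp_scaleA rp_scale1 rp_scaleDr rp_scaleDl.

Lemma clsN x : - cls x = cls (bddN x). Proof. exact: rp_oppE. Qed.

Lemma clsD x y : cls x + cls y = cls (bddD x y). Proof. exact: rp_addE. Qed.

Lemma clsZ k x : k *: cls x = cls (bddZ k x). Proof. exact: rp_scaleE. Qed.

Fact rp_normD p q : rp_norm (p + q) <= rp_norm p + rp_norm q.
Proof.
have [[x ->] [y ->]] := (clsP p, clsP q).
by rewrite clsD !rpE -rmorphD lecR limsup_rnormD.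
Qed.

Fact rp_normZ k p : rp_norm (k *: p) = `|k| * rp_norm p.
Proof.
have [x ->] := clsP p; rewrite clsZ !rpE.
have -> : `|k| = (complex.Re `|k|)%:C by rewrite RRe_real ?ger0_real.
rewrite -rmorphM; congr (_%:C); apply/eqP; rewrite eq_le limsup_rnormZ_le andTb.
have [->|k0] := eqVneq k 0.
  by rewrite normr0 mul0r limsup_rnorm_ge0.
(* The upper bound for [k^-1], applied to [k *: x], gives the reverse inequality. *)
have -> : limsup_rnorm x = limsup_rnorm (bddZ k^-1 (bddZ k x)).
  apply/limsup_rnorm_null/null_distP => e e0; apply: nearW => n /=.
  by rewrite scalerA mulVf // scale1r subrr rnorm0 ltW.
have a0 : 0 < complex.Re `|k| by rewrite -ltcR RRe_real ?ger0_real ?normr_gt0.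
rewrite mulrC -ler_pdivlMr // mulrC (le_trans (limsup_rnormZ_le _ _)) //.
rewrite ler_wpM2r ?limsup_rnorm_ge0 //.
by rewrite -lecR fmorphV !RRe_real ?ger0_real // normfV.
Qed.

Fact rp_norm0_eq0 p : rp_norm p = 0 -> p = 0.
Proof.
have [x ->] := clsP p; rewrite rpE => -[x0]; apply/cls_eqP.
rewrite /null_dist -x0; apply/eqP/limsup_rnorm_null/null_distP => e e0.
by apply: nearW => n /=; rewrite subr0 subrr rnorm0 ltW.
Qed.

HB.instance Definition _ := Lmodule_isNormed.Build R[i] reduced_product
  rp_normD rp_normZ rp_norm0_eq0.

Lemma rnorm_cls x : rnorm (cls x) = limsup_rnorm x.
Proof. by rewrite /rnorm [`|_|]rp_normE. Qed.

(* If the classes of the [y k] are Cauchy with rate [e k], the sequence whose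
   n-th term is [y (k n) n], where [k n] is the largest index up to which the
   expected estimates hold at [n], is a representative of the limit. *)
Fact rp_complete (F : set_system reduced_product) :
  ProperFilter F -> cauchy F -> cvg F.
Proof.
move=> FF /(cauchyP F) Fc; pose e m : R := m.+1%:R^-1.
have e_gt0 m : 0 < e m by rewrite invr_gt0.
have e_le j m : (j <= m)%N -> e m <= e j.
  by move=> jk; rewrite lef_pV2 ?posrE // ler_nat.
have ballE p (r : R) q : ball p r%:C q <-> rnorm (p - q) < r.
  by rewrite -ball_normE /ball_ /= rnormE ltcR.
(* The Cauchy filter contains a ball of each radius [e m], centred at the class of [y m]; any two of
   these balls meet, whence [y_dist]. *)
have /choice[y yF] m : exists x, F (ball (cls x) (e m)%:C).
  have [|p Fp] := Fc (e m)%:C; first by rewrite ltcR.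
  by exists (repr p); rewrite clsK.
have y_dist j l : \forall n \near \oo, rnorm (y j n - y l n) <= e j + e l.
  have [p [/ballE yjp /ballE ylp]] :=
    @filter_ex _ _ _ _ (filterI (yF j) (yF l)).
  apply: (@limsup_rnorm_lt (bddD (y j) (bddN (y l)))).
  rewrite -rnorm_cls -clsD -clsN (le_lt_trans (rnorm_dist _ p _)) //.
  by rewrite ltrD // rnorm_sub.
pose good n m := forall j l, (j <= m)%N -> (l <= m)%N ->
  rnorm (y j n - y l n) <= e j + e l.
(* Capping the index at [n] makes the maximum finite; the default value 0 is itself good, as
   [y 0 n - y 0 n = 0]. *)
pose kmax n := (\max_(m < n.+1 | `[< good n m >]) m)%N.
have good_kmax n : good n (kmax n).
  rewrite /kmax; apply: big_ind => [|m l|m /asboolP//].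
    move=> j l; rewrite !leqn0 => /eqP-> /eqP->.
    by rewrite subrr rnorm0 addr_ge0 // ltW.
  by rewrite /maxn; case: ifP.
(* For fixed [j], [good n j] is a finite conjunction of eventual conditions, so it holds for all
   large [n]; [j <= n] puts [j] in the range of the maximum. *)
have le_kmax j : \forall n \near \oo, (j <= kmax n)%N.
  have good_j : \forall n \near \oo, forall i l : 'I_j.+1,
      rnorm (y i n - y l n) <= e i + e l.
    by apply: filter_forall => i; apply: filter_forall => l; apply: y_dist.
  apply: filterS2 (nbhs_infty_ge j) good_j => n jn good_j.
  apply: (@leq_bigmax_cond _ _ _ (Ordinal (jn : (j < n.+1)%N))).
  apply/asboolP => i l ij lj.
  exact: (good_j (Ordinal (ij : (i < j.+1)%N)) (Ordinal (lj : (l < j.+1)%N))).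
pose z n := y (kmax n) n.
(* Once [j <= kmax n], the estimate is [e (kmax n) + e j <= 2 * e j]. *)
have z_dist j : \forall n \near \oo, rnorm (z n - y j n) <= 2 * e j.
  apply: filterS (le_kmax j) => n jn.
  have := good_kmax n _ _ (leqnn _) jn; have := e_le _ _ jn.
  by rewrite /z; lra.
have z_bdd : exists M : R, \forall n \near \oo, rnorm (z n) <= M.
  have [M yM] := bdd_seqP (y 0%N); exists (2 * e 0%N + M).
  apply: filterS2 (z_dist 0%N) yM => n zn yn; rewrite -[z n](subrK (y 0%N n)).
  by rewrite (le_trans (rnormD _ _)) ?lerD.
apply/cvg_ex; exists (cls (BddSeq z_bdd)); apply/cvg_ballP => r r0.
have rE : (complex.Re r)%:C = r by rewrite RRe_real // gtr0_real.
move: r0; rewrite -rE ltcR; move: {r rE}(complex.Re r) => r r0.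
have r3 : 0 < r / 3 by rewrite divr_gt0.
(* The limit is within [2 * e j] of [y j], and [p] within [e j]; the sum stays below [r] when
   [e j < r / 3]. *)
have [j ej] := @filter_ex _ _ _ _ (near_infty_natSinv_lt (PosNum r3)).
apply: filterS (yF j) => p /ballE yjp; apply/ballE.
rewrite (le_lt_trans (rnorm_dist _ (cls (y j)) _)) //.
have : rnorm (cls (BddSeq z_bdd) - cls (y j)) <= 2 * e j.
  by rewrite clsN clsD rnorm_cls; apply: limsup_rnorm_le; apply: z_dist.
by move: ej yjp; rewrite /= -/(e j); lra.
Qed.

HB.instance Definition _ :=
  Uniform_isComplete.Build reduced_product rp_complete.

Fact rp_mulA : associative rp_mul.
Proof.
move=> p q r; have [[[x ->] [y ->]] [z ->]] := (clsP p, clsP q, clsP r).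
by rewrite !rpE; apply: cls_ext => n /=; rewrite mulrA.
Qed.

Fact rp_mul1 : left_id (cls bdd1) rp_mul.
Proof.
move=> p; have [x ->] := clsP p.
by rewrite !rpE; apply: cls_ext => n /=; rewrite mul1r.
Qed.

Fact rp_mulr1 : right_id (cls bdd1) rp_mul.
Proof.
move=> p; have [x ->] := clsP p.
by rewrite !rpE; apply: cls_ext => n /=; rewrite mulr1.
Qed.

Fact rp_mulDl : left_distributive rp_mul +%R.
Proof.
move=> p q r; have [[[x ->] [y ->]] [z ->]] := (clsP p, clsP q, clsP r).
by rewrite clsD !rpE clsD; apply: cls_ext => n /=; rewrite mulrDl.
Qed.

Fact rp_mulDr : right_distributive rp_mul +%R.
Proof.
move=> p q r; have [[[x ->] [y ->]] [z ->]] := (clsP p, clsP q, clsP r).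
by rewrite clsD !rpE clsD; apply: cls_ext => n /=; rewrite mulrDr.
Qed.

Fact rp_scaleAl k p q : k *: rp_mul p q = rp_mul (k *: p) q.
Proof.
have [[x ->] [y ->]] := (clsP p, clsP q).
by rewrite clsZ !rpE clsZ; apply: cls_ext => n /=; rewrite scalerAl.
Qed.

Fact rp_scaleAr k p q : k *: rp_mul p q = rp_mul p (k *: q).
Proof.
have [[x ->] [y ->]] := (clsP p, clsP q).
by rewrite clsZ !rpE clsZ; apply: cls_ext => n /=; rewrite scalerAr.
Qed.

Fact rp_normM p q : `|rp_mul p q| <= `|p| * `|q|.
Proof.
have [[x ->] [y ->]] := (clsP p, clsP q).
by rewrite !rnormE -rmorphM lecR rpE !rnorm_cls limsup_rnormM.
Qed.

Fact rp_norm1 : `|cls bdd1| = 1.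
Proof. by rewrite rnormE rnorm_cls limsup_rnorm1. Qed.

HB.instance Definition _ := isUnitalBanachAlgebra.Build R[i] reduced_product
  rp_mulA rp_mul1 rp_mulr1 rp_mulDl rp_mulDr rp_scaleAl rp_scaleAr
  rp_normM rp_norm1.

(* The ring structure of Defs is only inferred for a projection of
   [unitalBanachAlgType], hence this packed copy. *)
Definition reduced_product_algebra : unitalBanachAlgType R[i] :=
  reduced_product.

Lemma cls1 : cls bdd1 = 1 :> reduced_product_algebra. Proof. by []. Qed.

Lemma clsM x y :
  (cls x : reduced_product_algebra) * (cls y : reduced_product_algebra) =
  cls (bddM x y).
Proof. exact: rp_mulE. Qed.

Lemma cls_approx x y (e : R) :
  0 < e -> cls x = cls y -> \forall n \near \oo, rnorm (x n - y n) <= e.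
Proof. by move=> e0 /cls_eqP/null_distP; apply. Qed.

(* The perturbation lemma turns exact relations between classes into exact
   relations in almost all factors. *)
Lemma reduced_product_properly_infinite :
  properly_infinite reduced_product_algebra ->
  \forall n \near \oo, properly_infinite (A n).
Proof.
move=> /properly_infinite_isometriesP[p [q [r [s []]]]].
have [[[[a ->] [b ->]] [c ->]] [d ->]] := (clsP p, clsP q, clsP r, clsP s).
rewrite -cls1 !clsM => ba dc bc da.
have e0 : 0 < 4^-1 :> R by [].
apply: filterS2 (filterI (cls_approx e0 ba) (cls_approx e0 dc))
  (filterI (cls_approx e0 bc) (cls_approx e0 da)) => n /= [ban dcn].
rewrite !subr0 => -[bcn dan].
exact: (properly_infinite_perturb ban dcn bcn dan).
Qed.

End BoundedSequences.

(** * Operator norms and extended limits superior *)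

(** By homogeneity it suffices to evaluate [f] at [a] divided by its norm, which lies in the unit
    ball; [a = 0] is treated apart. *)
Lemma op_norm_le (R : realType) (A B : unitalBanachAlgType R[i])
    (f : {lrmorphism A -> B}) (M : R) (a : A) :
  (op_norm f <= M%:E)%E -> rnorm (f a) <= M * rnorm a.
Proof.
move=> fM; have f_le (b : A) : rnorm b <= 1 -> rnorm (f b) <= M.
  move=> b1; rewrite -lee_fin; apply: le_trans fM.
  by apply: ereal_sup_ubound; exists b.
have [->|a0] := eqVneq a 0; first by rewrite linear0 !rnorm0 mulr0.
have na0 : 0 < rnorm a.
  rewrite lt_neqAle rnorm_ge0 andbT eq_sym.
  by apply: contra_neq a0 => /rnorm0_eq0.
have rnormZC (V : normedModType R[i]) (v : V) :
    rnorm ((rnorm a)^-1%:C *: v) = (rnorm a)^-1 * rnorm v.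
  by rewrite rnormZ ger0_norm // lecR invr_ge0 ltW.
have := f_le ((rnorm a)^-1%:C *: a).
rewrite linearZ /= !rnormZC mulVf ?gt_eqF // => /(_ (lexx _)).
by rewrite mulrC ler_pdivrMr.
Qed.

Section LimsupSequence.
Variables (R : realType) (u : nat -> \bar R).

(** [limn_esup] is the infimum, over the sets [V] of the filter, of the suprema over [V], so some
    [V] has supremum below [r]. *)
Lemma limn_esup_le_near (r : R) :
  (limn_esup u < r%:E)%E -> \forall k \near \oo, (u k <= r%:E)%E.
Proof.
move=> /ereal_inf_lt[_ [V VF <-]] sup_r.
apply: filterS VF => k Vk; apply: le_trans (ltW sup_r).
by apply: ereal_sup_ubound; exists k.
Qed.

Lemma limn_esup_near_bounded :
  (limn_esup u < +oo)%E -> exists M : R, \forall k \near \oo, (u k <= M%:E)%E.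
Proof.
case E : (limn_esup u) => [s| |] // _.
  by exists (s + 1); apply: limn_esup_le_near; rewrite E lte_fin ltrDl.
(* The limit superior is minus infinity here, so any real is an eventual bound. *)
by exists 0; apply: limn_esup_le_near; rewrite E ltNyr.
Qed.

End LimsupSequence.

(** * The cone of tails into the reduced product *)

Section TailCone.
Variables (R : realType) (A : nat -> unitalBanachAlgType R[i]).
Variable phi : forall i j : nat, (i <= j)%N -> {lrmorphism A i -> A j}.
Hypothesis phi_sys : inductive_system phi.

(** [phi] takes the inequality as an argument, hence the match on [idP]; the zeros below index [i]
    do not affect the class. *)
Definition tail i (a : A i) (n : nat) : A n :=
  match @idP (i <= n)%N with ReflectT le_in => phi le_in a | ReflectF _ => 0 end.

Lemma tailE i n (le_in : (i <= n)%N) (a : A i) : tail a n = phi le_in a.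
Proof.
rewrite /tail; case: {-}_ / idP => [le_in'|//].
by rewrite (bool_irrelevance le_in' le_in).
Qed.

(** Passes from the indexing [n = i + k] of the limits superior to eventual statements in [n]. *)
Lemma tail_near i (P : forall n, A n -> Prop) (a : A i) :
  (\forall k \near \oo, P _ (phi (leq_addr k i) a)) ->
  \forall n \near \oo, P n (tail a n).
Proof.
move=> [N _ PN]; exists (i + N)%N => // n /= iNn.
have [k nE] : exists k, n = (i + k)%N.
  by exists (n - i)%N; rewrite subnKC // (leq_trans _ iNn) ?leq_addr.
rewrite nE leq_add2l in iNn *; rewrite (tailE (leq_addr k i)).
exact: PN.
Qed.

(** An eventual bound on the operator norms serves as [M] for all [a] at once, which makes the cone
    maps bounded. *)
Lemma tail_bound i : exists M : R, forall a : A i,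
  \forall n \near \oo, rnorm (tail a n) <= M * rnorm a.
Proof.
have [M phiM] := limn_esup_near_bounded (ind_limsup phi_sys i).
exists M => a; apply: (@tail_near _ (fun n x => rnorm x <= M * rnorm a)).
by apply: filterS phiM => k; apply: op_norm_le.
Qed.

Fact tail_bdd i (a : A i) :
  exists M : R, \forall n \near \oo, rnorm (tail a n) <= M.
Proof. by have [M aM] := tail_bound i; exists (M * rnorm a). Qed.

Definition tail_seq i (a : A i) : bdd_seq A := BddSeq (tail_bdd a).

Definition tail_cls i (a : A i) : reduced_product_algebra A := cls (tail_seq a).

Lemma tail_cls_ext i (a : A i) (x : bdd_seq A) :
  (forall n (le_in : (i <= n)%N), phi le_in a = x n) -> tail_cls a = cls x.
Proof.
move=> ax; apply/cls_eqP/null_distP => e e0.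
apply: filterS (nbhs_infty_ge i) => n le_in /=.
by rewrite (tailE le_in) ax subrr rnorm0 ltW.
Qed.

Fact tail_cls_linear i : linear (@tail_cls i).
Proof.
move=> k a b; rewrite /tail_cls [_ *: cls _]clsZ [cls _ + cls _]clsD.
by apply: tail_cls_ext => n le_in /=; rewrite !(tailE le_in) linearP.
Qed.

HB.instance Definition _ i := GRing.isLinear.Build R[i] (A i)
  (reduced_product_algebra A) *:%R (@tail_cls i) (@tail_cls_linear i).

Fact tail_cls_monoid_morphism i : monoid_morphism (@tail_cls i).
Proof.
split=> [|a b].
  by rewrite -cls1; apply: tail_cls_ext => n le_in; rewrite rmorph1.
rewrite /tail_cls clsM; apply: tail_cls_ext => n le_in /=.
by rewrite !(tailE le_in) rmorphM.
Qed.

HB.instance Definition _ i := GRing.isMonoidMorphism.Build (A i)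
  (reduced_product_algebra A) (@tail_cls i) (@tail_cls_monoid_morphism i).

Lemma tail_cls_cone :
  compatible_cone phi (fun i => @tail_cls i : {lrmorphism A i -> _}).
Proof.
split=> [i|i a|i j ij a] /=.
- have [M aM] := tail_bound i; exists M => a.
  by rewrite [rnorm _]rnorm_cls; apply: limsup_rnorm_le; apply: aM.
(* The right-hand side is an infimum of suprema over sets [V] of the filter, so the class norm is
   compared with each supremum. *)
- rewrite [rnorm _]rnorm_cls; apply: le_ereal_inf_tmp => _ [V VF <-].
  have V_le k : V k -> ((rnorm (phi (leq_addr k i) a))%:E <=
      ereal_sup ((fun k => (rnorm (phi (leq_addr k i) a))%:E) @` V))%E.
    by move=> Vk; apply: ereal_sup_ubound; exists k.
  move: V_le; case: (ereal_sup _) => [r| |] V_le; first 2 last.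
  (* [V] is nonempty, so the supremum cannot be minus infinity. *)
  + by have [k /V_le] := @filter_ex _ _ _ _ VF.
  + rewrite lee_fin; apply: limsup_rnorm_le.
    apply: (@tail_near _ (fun n x => rnorm x <= r)).
    by apply: filterS VF => k /V_le.
  + exact: leey.
(* Both tails agree from index [j] on, by composition of connecting maps. *)
- apply/cls_eqP/null_distP => e e0; apply: filterS (nbhs_infty_ge j) => n jn /=.
  rewrite (tailE jn) (tailE (leq_trans ij jn)).
  by rewrite (ind_comp phi_sys ij jn (leq_trans ij jn)) subrr rnorm0 ltW.
Qed.

End TailCone.

(** * From the limit through the reduced product to the factors *)

Theorem corollary4p6 (R : realType) (A : nat -> unitalBanachAlgType R[i])
    (phi : forall i j : nat, (i <= j)%N -> {lrmorphism A i -> A j})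
    (L : unitalBanachAlgType R[i])
    (iota : forall i : nat, {lrmorphism A i -> L}) :
  inductive_system phi ->
  is_inductive_limit phi iota ->
  properly_infinite L ->
  exists N : nat, forall n : nat, (N <= n)%N -> properly_infinite (A n).
Proof.
move=> phi_sys /lim_universal/(_ _ _ (tail_cls_cone phi_sys))[Phi _].
move=> /(rmorph_properly_infinite Phi)/reduced_product_properly_infinite.
by move=> [N _ AN]; exists N => n; apply: AN.
Qed.
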